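(* Let $q$ be a prime power and $n,k>1$ integers. Let $U$ be an $\mathbb{F}_q$-subspace of $\mathbb{F}_{q^n}^k$ such that $L_U$ is $(r,i)$-regular fat of rank $\rho$ with $i<n$. Then $$r\ \ge\ \frac{(q^{2\rho-nk}-1)\begin{bmatrix}n\\ 2\end{bmatrix}_q}{(q^n-1)\begin{bmatrix}i\\ 2\end{bmatrix}_q}.$$
   Context: For an $\mathbb{F}_q$-subspace $U$ of $\mathbb{F}_{q^n}^k$ with $\dim_{\mathbb{F}_q}U=\rho$, the linear set of rank $\rho$ associated with $U$ is $L_U=\{\langle v\rangle_{\mathbb{F}_{q^n}}\colon v\in U,\ v\ne0\}\subseteq\mathrm{PG}(k-1,q^n)$, and the weight of a point $\langle v\rangle_{\mathbb{F}_{q^n}}$ is $\dim_{\mathbb{F}_q}(\langle v\rangle_{\mathbb{F}_{q^n}}\cap U)$. For integers $r\ge0$, $i\ge2$, $L_U$ is $(r,i)$-regular fat if it has exactly $r$ points of weight $i$, all its remaining points have weight one, and there is at least one point of weight one. $\begin{bmatrix}a\\ h\end{bmatrix}_q$ is the Gaussian binomial coefficient, the number of $h$-dimensional subspaces of $\mathbb{F}_q^a$; in particular $\begin{bmatrix}a\\ 2\end{bmatrix}_q=\frac{(q^a-1)(q^{a-1}-1)}{(q^2-1)(q-1)}$ for $a\ge2$. The exponent $2\rho-nk$ may be negative. *)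

(* Defs.v *)
From HB Require Import structures.
From mathcomp Require Import all_boot all_order all_algebra all_field.

Set Implicit Arguments.
Unset Strict Implicit.
Unset Printing Implicit Defensive.

Import Order.TTheory GRing.Theory Num.Theory.
Local Open Scope ring_scope.

HB.instance Definition _ (F : finFieldType) (vT : vectType F) :=
  isCountable.Build {vspace vT}
    (pcan_pickleK (can_pcan (@VectorInternalTheory.vs2mxK F vT))).
HB.instance Definition _ (F : finFieldType) (vT : vectType F) :=
  isFinite.Build {vspace vT}
    (pcan_enumP (can_pcan (@VectorInternalTheory.vs2mxK F vT))).

Definition gauss_binom (F : finFieldType) (a h : nat) : nat :=
  #|[set W : {vspace 'rV[F]_a} | \dim W == h]|.

Section LinearSets.

Variables (F : finFieldType) (L : fieldExtType F) (k : nat).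

(* L^k is taken as {ffun 'I_k -> L} because its canonical scalars are F, so
   that {vspace {ffun 'I_k -> L}} is the type of F-subspaces of L^k and \dim is
   the dimension over F. *)
Local Notation V := {ffun 'I_k -> L}.

Definition scaleL (v : V) (a : L) : V := [ffun j => a * v j].

Fact scaleL_is_linear (v : V) : linear (scaleL v).
Proof. by move=> c a b; apply/ffunP=> j; rewrite !ffunE mulrDl scalerAl. Qed.

HB.instance Definition _ (v : V) :=
  GRing.isLinear.Build F L V *:%R (scaleL v) (scaleL_is_linear v).

(* The L-span <v>_L, regarded as an F-subspace of L^k.  The points of
   PG(k - 1, L) are the subspaces Lspan v with v != 0. *)
Definition Lspan (v : V) : {vspace V} := limg (linfun (scaleL v)).

Lemma LspanP (v w : V) :
  reflect (exists a : L, w = [ffun j => a * v j]) (w \in Lspan v).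
Proof.
apply: (iffP memv_imgP) => [[a _ ->] | [a ->]]; exists a => //.
- by rewrite lfunE.
- by rewrite memvf.
- by rewrite lfunE.
Qed.

(* finvect_type V is V with its structure of finite type. *)
Definition linear_set (U : {vspace V}) : {set {vspace V}} :=
  [set Lspan v | v : finvect_type V & ((v : V) \in U) && ((v : V) != 0)].

Definition weight (U P : {vspace V}) : nat := \dim (P :&: U).

Definition regular_fat (r i : nat) (U : {vspace V}) : Prop :=
  [/\ (2 <= i)%N,
      #|[set P in linear_set U | weight U P == i]| = r,
      forall P, P \in linear_set U -> weight U P != i -> weight U P = 1%N
    & exists2 P, P \in linear_set U & weight U P = 1%N].

Lemma linear_setP (U P : {vspace V}) :
  reflect (exists v : V, [/\ v \in U, v != 0 & P = Lspan v])
          (P \in linear_set U).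
Proof.
apply: (iffP imsetP) => [[v] | [v [Uv v0 ->]]].
  by rewrite inE => /andP[Uv v0] ->; exists v.
by exists (v : finvect_type V) => //; rewrite inE Uv v0.
Qed.

End LinearSets.

(* Main.v *)
From HB Require Import structures.
Require Import Defs.
From mathcomp Require Import all_boot all_order all_algebra all_field.
From mathcomp Require Import zify.

Set Implicit Arguments.
Unset Strict Implicit.
Unset Printing Implicit Defensive.

Import Order.TTheory GRing.Theory Num.Theory.
Local Open Scope ring_scope.

(** The bound is a double count of the pairs (u, a) with u a nonzero vector of
    U, a a scalar of L outside F, and a u again in U.

    Fix u first.  The scalars a with a u in U form an F-subspace of L that
    contains F and is isomorphic to <u>_L :&: U, so u lies in q ^ w - q pairs,
    where w is the weight of the point <u>_L; and a point of weight w carries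
    q ^ w - 1 vectors u.  The number of pairs is thus the sum over the points
    of L_U of (q ^ w - 1)(q ^ w - q) ([sum_weight_pairs]).  Points of weight
    one contribute nothing, so that for an (r, i)-regular fat linear set it is
    r (q ^ i - 1)(q ^ i - q).

    Fix a first.  Since a <> 0, multiplication by a is an F-automorphism of
    L^k, and U meets the preimage of U under it in dimension at least
    2 rho - n k ([dim_cap_homothety]).  Each of the q ^ n - q scalars outside F
    therefore lies in at least q ^ (2 rho - n k) - 1 pairs ([sum_weight_ge]).

    Comparing the two counts gives
      (q ^ n - q)(q ^ (2 rho - n k) - 1) <= r (q ^ i - 1)(q ^ i - q),
    which is the theorem once (q ^ a - 1)(q ^ a - q), the number of ordered
    independent pairs in F^a, is read as the Gaussian binomial of a and 2
    times the number of ordered bases of a plane ([gauss_binom2]).  When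
    2 rho < n k the left-hand side of the theorem is at most 0. *)

(** * Counting vectors and planes over a finite field *)

Section CountingVectors.

Variables (F : finFieldType) (vT : vectType F).
Local Notation q := #|F|.
Local Notation fT := (finvect_type vT).
Implicit Types V W : {vspace vT}.

Lemma card_vspace_pred V : #|[pred v : fT | (v : vT) \in V]| = (q ^ \dim V)%N.
Proof.
(* Only once vT is an explicit record is it convertible to the vector space
   that card_vspace builds on the finite type fT. *)
case: vT V => T c V.
rewrite -(@card_vspace F (finvect_type (Vector.Pack c)) c V).
by apply: eq_card => v.
Qed.

Lemma card_vspaceD V W : (W <= V)%VS ->
  #|[pred v : fT | ((v : vT) \in V) && ((v : vT) \notin W)]|
    = (q ^ \dim V - q ^ \dim W)%N.
Proof.
move=> /subvP sWV; rewrite -!card_vspace_pred.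
rewrite -(cardID [pred v : fT | (v : vT) \in W] [pred v : fT | (v : vT) \in V]).
rewrite (_ : #|predI _ _| = #|[pred v : fT | (v : vT) \in W]|); last first.
  by apply: eq_card => v; rewrite !inE andbC; case: (boolP (_ \in W)) => // /sWV.
by rewrite addKn; apply: eq_card => v; rewrite !inE andbC.
Qed.

Lemma card_vspace_neq0 V :
  #|[pred v : fT | ((v : vT) \in V) && ((v : vT) != 0)]| = (q ^ \dim V - 1)%N.
Proof.
have := card_vspaceD (sub0v V); rewrite dimv0 expn0 => <-.
by apply: eq_card => v; rewrite !inE memv0.
Qed.

Lemma sum_free_pairs V :
  (\sum_(p : fT * fT | [&& (p.1 : vT) \in V, (p.2 : vT) \in V
                         & free [:: p.2 : vT; p.1 : vT]]) 1
    = (q ^ \dim V - 1) * (q ^ \dim V - q))%N.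
Proof.
transitivity (\sum_(u : fT | ((u : vT) \in V) && ((u : vT) != 0%R))
   \sum_(v : fT | ((v : vT) \in V) && ((v : vT) \notin <[u : vT]>%VS)) 1)%N.
  rewrite pair_big_dep; apply: eq_bigl => -[u v] /=.
  by rewrite free_cons seq1_free span_seq1; do !case: (_ \in _); case: (_ != _).
rewrite -card_vspace_neq0 -sum_nat_const; apply: eq_bigr => u /andP[Vu u0].
rewrite sum1_card card_vspaceD -?memvE //.
by rewrite dim_vline u0.
Qed.

(** Sorting the free pairs of the whole space by the plane that they span: the
    fibre over a plane W consists of the free pairs of W. *)
Lemma card_planes :
  (#|[set W : {vspace vT} | \dim W == 2]| * ((q ^ 2 - 1) * (q ^ 2 - q))
    = (q ^ \dim {:vT} - 1) * (q ^ \dim {:vT} - q))%N.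
Proof.
rewrite -(sum_free_pairs fullv) -sum_nat_const.
rewrite (partition_big (fun p : fT * fT => <<[:: p.2 : vT; p.1 : vT]>>%VS)
           (fun W : {vspace vT} => W \in [set W : {vspace vT} | \dim W == 2])).
  2: by case=> u v /and3P[_ _ /eqP fuv]; rewrite inE /= fuv.
apply: eq_bigr => W; rewrite inE => /eqP dW.
rewrite -{1 2}dW -sum_free_pairs; apply: eq_bigl => -[u v] /=.
rewrite !memvf /= andbC; case fuv: (free _); rewrite ?andbF ?andbT //=.
apply/andP/eqP => [[Wu Wv]|<-]; last by rewrite !memv_span ?inE ?eqxx ?orbT.
apply/eqP; rewrite eqEdim (eqP fuv) dW leqnn andbT.
by apply/span_subvP => x; rewrite !inE => /orP[]/eqP->.
Qed.

Lemma dim_lpreim (rT : vectType F) (f : 'Hom(vT, rT)) (W : {vspace rT}) :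
  injective f -> \dim (f @^-1: W) = \dim (W :&: limg f).
Proof.
move=> /lker0P/eqP kf0; rewrite -lpreim_cap_limg -(@limg_dim_eq _ _ _ f).
  by rewrite lpreimK // capvSr.
by rewrite kf0 capv0.
Qed.

End CountingVectors.

Lemma gauss_binom2 (F : finFieldType) a :
  (gauss_binom F a 2 * ((#|F| ^ 2 - 1) * (#|F| ^ 2 - #|F|))
    = (#|F| ^ a - 1) * (#|F| ^ a - #|F|))%N.
Proof. by rewrite /gauss_binom card_planes dimvf /dim /= mul1n. Qed.

(** * The double count for an arbitrary linear set *)

Section LinearSetCount.

Variables (F : finFieldType) (L : fieldExtType F) (k : nat).
Local Notation q := #|F|.
Local Notation V := {ffun 'I_k -> L}.
Local Notation fV := (finvect_type V).
Local Notation fL := (finvect_type L).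
Implicit Types (U P : {vspace V}) (u v : V) (a : L).

(** The product of a scalar and a vector, as an F-linear map of the vector;
    scaleL is the same product as a linear map of the scalar. *)
Definition homothety a v : V := scaleL v a.

Fact homothety_is_linear a : linear (homothety a).
Proof. by move=> c u v; apply/ffunP => j; rewrite !ffunE mulrDr scalerAr. Qed.

HB.instance Definition _ a :=
  GRing.isLinear.Build F V V *:%R (homothety a) (homothety_is_linear a).

Lemma homothety_inj a : a != 0 -> injective (homothety a).
Proof.
move=> a0 u v /ffunP eq_uv; apply/ffunP => j.
by have := eq_uv j; rewrite !ffunE; apply: mulfI.
Qed.

Lemma scaleL_inj v : v != 0 -> injective (scaleL v).
Proof.
move=> v0 a b /ffunP eq_ab.
have [j vj0] : exists j, v j != 0.
  apply/existsP; apply: contraNT v0 => /existsPn v0.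
  by apply/eqP/ffunP => j; rewrite ffunE; apply/eqP; have /negPn := v0 j.
by have := eq_ab j; rewrite !ffunE; apply: mulIf.
Qed.

(** Both U and its preimage have dimension \dim U inside a space of dimension
    \dim {: L} * k, so Grassmann's formula applies.  The subtraction is
    truncated, which loses nothing: a dimension is never negative. *)
Lemma dim_cap_homothety U a : a != 0 ->
  (2 * \dim U - \dim {: L} * k <= \dim (U :&: linfun (homothety a) @^-1: U))%N.
Proof.
move=> a0.
have inj_h : injective (linfun (homothety a)).
  by move=> u v; rewrite !lfunE; apply: homothety_inj.
have dU : \dim (linfun (homothety a) @^-1: U) = \dim U.
  rewrite dim_lpreim // lker0_limgf ?capvf //.
  exact/lker0P.
have dV : \dim {: V} = (\dim {: L} * k)%N.
  by rewrite !dimvf {1}/dim /= card_ord mulnC.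
have := dimv_sum_cap U (linfun (homothety a) @^-1: U).
have := dimvS (subvf (U + linfun (homothety a) @^-1: U)).
by rewrite dU dV; lia.
Qed.

Lemma Lspan_refl v : v \in Lspan v.
Proof. by apply/LspanP; exists 1; apply/ffunP => j; rewrite ffunE mul1r. Qed.

Lemma Lspan_eq u v : u != 0 -> (Lspan u == Lspan v) = (u \in Lspan v).
Proof.
move=> u0; apply/eqP/idP => [<-|/LspanP[a def_u]]; first exact: Lspan_refl.
have a0 : a != 0.
  apply: contraNneq u0 => a0; apply/eqP/ffunP => j.
  by rewrite def_u a0 !ffunE mul0r.
apply/vspaceP => w; apply/LspanP/LspanP => -[b ->].
  by exists (b * a); apply/ffunP => j; rewrite def_u !ffunE mulrA.
by exists (b / a); apply/ffunP => j; rewrite def_u !ffunE mulrA divfK.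
Qed.

(** The multipliers of u form the preimage of U under the injection scaleL u,
    whose image is Lspan u; this preimage contains F because u is in U. *)
Lemma card_multipliers U u : u \in U -> u != 0 ->
  #|[pred a : fL | (scaleL u a \in U) && ((a : L) \notin 1%VS)]|
    = (q ^ weight U (Lspan u) - q)%N.
Proof.
move=> Uu u0; have su_inj : injective (linfun (scaleL u)).
  by move=> a b; rewrite !lfunE; apply: scaleL_inj.
have sub1 : (1 <= linfun (scaleL u) @^-1: U)%VS.
  apply/subvP => a /vlineP[c ->]; rewrite -memv_preim lfunE /=.
  suff -> : scaleL u (c *: 1) = c *: u by rewrite rpredZ.
  by rewrite linearZ /=; congr (_ *: _); apply/ffunP => j; rewrite ffunE mul1r.
have := card_vspaceD sub1; rewrite dimv1 expn1 dim_lpreim // capvC => <-.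
by apply: eq_card => a; rewrite !inE -memv_preim lfunE.
Qed.

(** The count of the pairs (u, a) by vectors.  The vectors u are grouped by
    the point Lspan u, and those lying on a point P are the nonzero vectors of
    P :&: U. *)
Lemma sum_weight_pairs U :
  (\sum_(u : fV | ((u : V) \in U) && ((u : V) != 0%R))
      #|[pred a : fL | (scaleL u a \in U) && ((a : L) \notin 1%VS)]|
   = \sum_(P in linear_set U)
       (q ^ weight U P - 1) * (q ^ weight U P - q))%N.
Proof.
rewrite (partition_big (fun u : fV => Lspan (u : V))
           (fun P => P \in linear_set U)); last first.
  by move=> u /andP[Uu u0]; apply/linear_setP; exists (u : V).
apply: eq_bigr => P /linear_setP[v [Uv v0 ->]].
rewrite /weight -card_vspace_neq0 -sum_nat_const.
apply: eq_big => [u|u /andP[/andP[Uu u0] /eqP eq_uv]].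
  rewrite !inE memv_cap; case: (boolP ((u : V) == 0)) => [|u0].
    by rewrite !andbF.
  by rewrite Lspan_eq // !andbT andbC.
by rewrite card_multipliers // /weight eq_uv.
Qed.

(** The count of the same pairs by scalars: the u that go with a given a are
    the nonzero vectors of the space bounded in [dim_cap_homothety]. *)
Lemma sum_weight_ge U :
  ((q ^ \dim {: L} - q) * (q ^ (2 * \dim U - \dim {: L} * k) - 1)
   <= \sum_(P in linear_set U)
        (q ^ weight U P - 1) * (q ^ weight U P - q))%N.
Proof.
rewrite -sum_weight_pairs.
under eq_bigr => u _ do rewrite -sum1_card.
rewrite (exchange_big_dep (fun a : fL => (a : L) \notin 1%VS)) /=; last first.
  by move=> u a _ /andP[].
have -> : (q ^ \dim {: L} - q)%N = #|[pred a : fL | (a : L) \notin 1%VS]|.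
  have := card_vspaceD (subvf (1%VS : {vspace L})); rewrite dimv1 expn1 => <-.
  by apply: eq_card => a; rewrite !inE memvf.
rewrite -sum_nat_const; apply: leq_sum => a; rewrite inE => a1.
have a0 : (a : L) != 0 by apply: contraNneq a1 => ->; rewrite mem0v.
apply: (@leq_trans (q ^ \dim (U :&: linfun (homothety a) @^-1: U) - 1)).
  rewrite leq_sub2r // leq_exp2l ?dim_cap_homothety //.
  exact: finNzRing_gt1.
rewrite -card_vspace_neq0 -sum1_card.
apply: eq_leq; apply: eq_bigl => u.
by rewrite !inE memv_cap -memv_preim lfunE /= a1 andbT andbAC.
Qed.

Lemma regular_fat_sum_weight r i U : regular_fat r i U ->
  (\sum_(P in linear_set U) (q ^ weight U P - 1) * (q ^ weight U P - q)
   = r * ((q ^ i - 1) * (q ^ i - q)))%N.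
Proof.
case=> _ <- w1 _; rewrite (bigID (fun P => weight U P == i)) /= addnC big1.
  rewrite add0n -sum_nat_const; apply: eq_big => [P|P /andP[_ /eqP->]] //.
  by rewrite inE.
by move=> P /andP[LP wP]; rewrite (w1 P LP wP) expn1 subnn muln0.
Qed.

End LinearSetCount.

(** * The bound for regular fat linear sets *)

Theorem theorem5p9 (q n k : nat) (F : finFieldType) (L : fieldExtType F)
    (hq : #|F| = q) (hL : \dim {: L} = n) (hn : (1 < n)%N) (hk : (1 < k)%N)
    (U : {vspace {ffun 'I_k -> L}}) (r i rho : nat)
    (hrho : \dim U = rho) (hU : regular_fat r i U) (hi : (i < n)%N) :
  (((q%:R : rat) ^ (2 * rho%:Z - n%:Z * k%:Z) - 1) * (gauss_binom F n 2)%:R)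
    / (((q%:R : rat) ^+ n - 1) * (gauss_binom F i 2)%:R)
  <= (r%:R : rat).
Proof.
have i2 : (2 <= i)%N by case: hU.
have q1 : (1 < q)%N by rewrite -hq finNzRing_gt1.
have := sum_weight_ge U; rewrite (regular_fat_sum_weight hU) hq hL hrho => main.
have Gn := gauss_binom2 F n; have Gi := gauss_binom2 F i.
rewrite hq in Gn Gi.
set c := ((q ^ 2 - 1) * (q ^ 2 - q))%N in Gn Gi.
have q_lt m : (1 < m)%N -> (q < q ^ m)%N.
  by move=> m1; rewrite -{1}(expn1 q) ltn_exp2l.
have pairs_gt0 m : (1 < m)%N -> (0 < (q ^ m - 1) * (q ^ m - q))%N.
  by move=> m1; rewrite muln_gt0 !subn_gt0 q_lt // (ltn_trans q1) ?q_lt.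
have c0 : (0 < c)%N by exact: pairs_gt0.
have gi0 : (0 < gauss_binom F i 2)%N.
  by have := pairs_gt0 i i2; rewrite -Gi muln_gt0 => /andP[].
have Q1 : (0 : rat) < q%:R ^+ n - 1.
  by rewrite subr_gt0 -natrX ltr1n (ltn_trans q1) ?q_lt.
rewrite ler_pdivrMr ?mulr_gt0 ?ltr0n //.
have [neg|nneg] := ltnP (2 * rho) (n * k).
  apply: (@le_trans _ _ 0); last by rewrite !mulr_ge0 ?ler0n // ltW.
  rewrite mulr_le0_ge0 ?ler0n // subr_le0.
  have -> : (2 * rho%:Z - n%:Z * k%:Z) = - ((n * k - 2 * rho)%N%:Z) by lia.
  by rewrite -exprnN invf_le1 ?exprn_ege1 ?ler1n ?exprn_gt0 ?ltr0n // ltnW.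
have -> : (2 * rho%:Z - n%:Z * k%:Z) = (2 * rho - n * k)%N%:Z by lia.
(* Multiplying by c turns both Gaussian binomials into counts of pairs. *)
rewrite -exprnP -(ler_pM2r (_ : 0 < c%:R :> rat)) ?ltr0n //.
have -> : (1 : rat) = 1%:R by [].
rewrite -!natrX -!natrB ?expn_gt0 ?(ltnW q1) // -!natrM ler_nat.
rewrite -mulnA Gn -(mulnA r) -(mulnA (q ^ n - 1)%N) Gi mulnCA.
rewrite [leqRHS]mulnCA.
by rewrite leq_mul2l (mulnC _ (q ^ n - q)%N) main orbT.
Qed.
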